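(* Let $X=\mathbb{R}\times S^1$. The moduli space $\mathcal M(\mathbb{R}\times S^1)=\operatorname{Neg}(\mathbb{R}\times S^1)/\operatorname{Diff}(\mathbb{R}\times S^1)$, with the quotient topology, is disconnected.
   Context: For a smooth surface $X$, $\operatorname{Neg}(X)$ is the set of complete Riemannian metrics $g$ on $X$ with uniformly negative curvature, i.e. such that there is a constant $a>0$ (depending on $g$) with Gaussian curvature $K_g\le -a$ on all of $X$. It carries the intrinsic uniform $C^2$ topology, in which a neighbourhood basis of $g\in\operatorname{Neg}(X)$ is given, for $\lambda>1$ and $\epsilon>0$, by the sets $N_{g,\lambda,\epsilon}$ of all $h\in\operatorname{Neg}(X)$ with $$\sup_{x\in X}\sup_{0\ne v\in T_xX}\Big|\log\frac{h_x(v,v)}{g_x(v,v)}\Big|<\log\lambda,\qquad \sup_{x\in X}\big(|\nabla^g(h-g)|_g+|(\nabla^g)^2(h-g)|_g\big)<\epsilon,$$ where $\nabla^g$ and $|\cdot|_g$ are the Levi-Civita connection and the tensor norms of $g$. $\operatorname{Diff}(X)$ is the group of diffeomorphisms of $X$, acting on $\operatorname{Neg}(X)$ by pullback, and $\operatorname{Neg}(X)/\operatorname{Diff}(X)$ has the quotient topology. $S^1=\mathbb{R}/\mathbb{Z}$. *)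

(* Defs.v *)
From HB Require Import structures.
From mathcomp Require Import all_boot all_order all_algebra.
From mathcomp Require Import generic_quotient.
From mathcomp Require Import all_classical all_reals all_analysis.

Set Implicit Arguments.
Unset Strict Implicit.
Unset Printing Implicit Defensive.
Import Order.TTheory GRing.Theory Num.Theory.
Import numFieldNormedType.Exports.
Local Open Scope classical_set_scope.
Local Open Scope ring_scope.

Section Circle.
Variable R : realType.

Definition circle_rel : rel R := fun x y => x - y \is a Num.int.

Lemma circle_rel_equiv : equiv_class_of circle_rel.
Proof.
rewrite /circle_rel; split=> [x|x y|y x z]; first by rewrite subrr.
  by rewrite -opprB rpredN.
by move=> xy yz; rewrite -[x](subrK y) -addrA rpredD.
Qed.

Canonical circle_equiv := EquivRelPack circle_rel_equiv.
Canonical circle_encModRel := defaultEncModRel circle_rel.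

Definition circle : Type := {eq_quot circle_rel}%qT.

HB.instance Definition _ : EqQuotient R circle_rel circle :=
  EqQuotient.on circle.
HB.instance Definition _ := Choice.on circle.

End Circle.

Definition cylinder (R : realType) : Type := (R * circle R)%type.

(* The projection from the plane onto the cylinder.  The smooth structure of
   the cylinder is the one for which [cylproj] is a local diffeomorphism: its
   charts are the local inverses of [cylproj].  The coordinate fields of the plane
   are invariant under integer translations of the second coordinate, hence
   descend to a global frame of the tangent bundle, through which every tangent
   space of the cylinder is identified with 'rV[R]_2. *)
Definition cylproj (R : realType) (p : 'rV[R]_2) : cylinder R :=
  (p 0 0, \pi_(circle R)%qT (p 0 1)).

Section Smoothness.
Context {R : realType}.

Definition ebase (i : 'I_2) : 'rV[R]_2 := delta_mx 0 i.

(* All partial derivatives of order at most n exist and are continuous on the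
   open set U. *)
Fixpoint Ck_on {W : normedModType R} (U : set 'rV[R]_2) (n : nat)
    (f : 'rV[R]_2 -> W) : Prop :=
  (forall p, U p -> {for p, continuous f}) /\
  match n with
  | 0 => True
  | n'.+1 => forall i, (forall p, U p -> derivable f p (ebase i)) /\
                       Ck_on U n' ('D_(ebase i) f)
  end.

Definition smooth_on {W : normedModType R} (U : set 'rV[R]_2)
    (f : 'rV[R]_2 -> W) : Prop :=
  forall n, Ck_on U n f.

(* F is the expression of phi near p in charts of the cylinder. *)
Definition local_lift (phi : cylinder R -> cylinder R) (p : 'rV[R]_2)
    (F : 'rV[R]_2 -> 'rV[R]_2) : Prop :=
  exists U : set 'rV[R]_2, [/\ open_nbhs p U, smooth_on U F &
    forall q, U q -> cylproj (F q) = phi (cylproj q)].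

Definition smooth_map (phi : cylinder R -> cylinder R) : Prop :=
  forall p, exists F, local_lift phi p F.

Definition diffeomorphism (phi : cylinder R -> cylinder R) : Prop :=
  smooth_map phi /\
  exists psi, [/\ smooth_map psi, cancel phi psi & cancel psi phi].

End Smoothness.

Section Metrics.
Context {R : realType}.

Definition bilin (A : 'M[R]_2) (v w : 'rV[R]_2) : R := (v *m A *m w^T) 0 0.

(* A field of bilinear forms on the cylinder, given by its Gram matrix in the
   global coordinate frame. *)
Definition form_field := cylinder R -> 'M[R]_2.

Definition riemannian (g : form_field) : Prop :=
  [/\ forall i j, smooth_on setT (fun p => g (cylproj p) i j : R^o),
      forall x, (g x)^T = g x &
      forall x v, v != 0 -> 0 < bilin (g x) v v].

Section Tensors.
Variable g : form_field.

(* [metric p i j] and [cometric p i j] are the coefficients g_ij and g^ij. *)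
Definition metric (p : 'rV[R]_2) : 'M[R]_2 := g (cylproj p).
Definition cometric (p : 'rV[R]_2) : 'M[R]_2 := invmx (metric p).

Definition partial (i : 'I_2) (f : 'rV[R]_2 -> R) (p : 'rV[R]_2) : R :=
  'D_(ebase i) (f : 'rV[R]_2 -> R^o) p.

Definition christoffel (k i j : 'I_2) (p : 'rV[R]_2) : R :=
  2^-1 * \sum_l cometric p k l *
    (partial i (fun q => metric q j l) p + partial j (fun q => metric q i l) p
     - partial l (fun q => metric q i j) p).

(* The coefficient R^l_kij, where
   R(d_i, d_j) d_k = (nabla_i nabla_j - nabla_j nabla_i) d_k
                   = \sum_l R^l_kij d_l. *)
Definition riemann (l k i j : 'I_2) (p : 'rV[R]_2) : R :=
  partial i (christoffel l j k) p - partial j (christoffel l i k) p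
  + \sum_m (christoffel l i m p * christoffel m j k p
            - christoffel l j m p * christoffel m i k p).

(* K = <R(d_0, d_1) d_1, d_0> / (g_00 g_11 - g_01 ^ 2). *)
Definition gauss_curvature (p : 'rV[R]_2) : R :=
  (\sum_l riemann l 1 0 1 p * metric p l 0) / \det (metric p).

(* Covariant tensor fields of rank r on the plane, by components. *)
Definition tensor_field (r : nat) := {ffun 'I_r -> 'I_2} -> 'rV[R]_2 -> R.

Definition subst_index (r : nat) (I : {ffun 'I_r -> 'I_2}) (s : 'I_r)
    (m : 'I_2) : {ffun 'I_r -> 'I_2} :=
  [ffun t => if t == s then m else I t].

(* The Levi-Civita covariant derivative; the new index comes first. *)
Definition nabla (r : nat) (T : tensor_field r) : tensor_field r.+1 :=
  fun I p =>
    let k := I ord0 in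
    let J := [ffun s => I (lift ord0 s)] in
    partial k (T J) p
    - \sum_s \sum_m christoffel m k (J s) p * T (subst_index J s m) p.

Definition tensor_norm (r : nat) (T : tensor_field r) (p : 'rV[R]_2) : R :=
  Num.sqrt (\sum_(I : {ffun 'I_r -> 'I_2}) \sum_(J : {ffun 'I_r -> 'I_2})
    (\prod_s cometric p (I s) (J s)) * T I p * T J p).

End Tensors.

(* A C^1 arc in the plane; only its restriction to [0, 1] is used.  (Every C^1
   map on [0, 1] extends to the line.) *)
Definition C1_arc (c : R -> 'rV[R]_2) : Prop :=
  (forall t, derivable c t 1) /\ continuous (derive1 c).

(* A piecewise C^1 curve from x to y in the cylinder, as a finite concatenation
   of images by [cylproj] of C^1 arcs (each C^1 arc of the cylinder that lies in
   the domain of a chart is such an image). *)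
Fixpoint curve_from_to (s : seq (R -> 'rV[R]_2)) (x y : cylinder R) : Prop :=
  match s with
  | [::] => x = y
  | c :: s' => [/\ C1_arc c, cylproj (c 0) = x & curve_from_to s' (cylproj (c 1)) y]
  end.

Definition arc_length (g : form_field) (c : R -> 'rV[R]_2) : \bar R :=
  (\int[lebesgue_measure]_(t in `[0%R, 1%R])
     (Num.sqrt (bilin (g (cylproj (c t))) (derive1 c t) (derive1 c t)))%:E)%E.

Definition curve_length (g : form_field) (s : seq (R -> 'rV[R]_2)) : \bar R :=
  (\sum_(c <- s) arc_length g c)%E.

Definition riemannian_dist (g : form_field) (x y : cylinder R) : \bar R :=
  ereal_inf [set curve_length g s | s in [set s | curve_from_to s x y]].

Definition complete_metric (g : form_field) : Prop :=
  forall u : nat -> cylinder R,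
    (forall e : R, 0 < e -> exists N, forall m n, (N <= m)%N -> (N <= n)%N ->
       (riemannian_dist g (u m) (u n) < e%:E)%E) ->
    exists x, forall e : R, 0 < e -> exists N, forall n, (N <= n)%N ->
       (riemannian_dist g (u n) x < e%:E)%E.

Definition uniformly_negative (g : form_field) : Prop :=
  exists2 a : R, 0 < a & forall p, gauss_curvature g p <= - a.

End Metrics.

Arguments form_field : clear implicits.

Record Neg (R : realType) := MkNeg {
  neg_form :> form_field R;
  neg_riemannian : riemannian neg_form;
  neg_complete : complete_metric neg_form;
  neg_curvature : uniformly_negative neg_form
}.

HB.instance Definition _ (R : realType) := gen_eqMixin (Neg R).
HB.instance Definition _ (R : realType) := gen_choiceMixin (Neg R).

Section Topology.
Context {R : realType}.

Definition log_distortion (g h : Neg R) : \bar R :=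
  ereal_sup [set ereal_sup
    [set (`|ln (bilin (neg_form h x) v v / bilin (neg_form g x) v v)|)%:E
      | v in [set v : 'rV[R]_2 | v != 0]]
    | x in [set: cylinder R]].

(* The tensor field h - g. *)
Definition metric_diff (g h : Neg R) : tensor_field 2 :=
  fun I p => metric h p (I 0) (I 1) - metric g p (I 0) (I 1).

Definition C2_deviation (g h : Neg R) : \bar R :=
  ereal_sup [set (tensor_norm g (nabla g (metric_diff g h)) p
                  + tensor_norm g (nabla g (nabla g (metric_diff g h))) p)%:E
    | p in [set: 'rV[R]_2]].

Definition C2_ball (g : Neg R) (lambda eps : R) : set (Neg R) :=
  [set h | (log_distortion g h < (ln lambda)%:E)%E /\
           (C2_deviation g h < eps%:E)%E].

Definition C2_open (U : set (Neg R)) : Prop :=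
  forall g, U g -> exists lambda eps,
    [/\ 1 < lambda, 0 < eps & C2_ball g lambda eps `<=` U].

Lemma C2_openT : C2_open setT.
Proof. by move=> g _; exists 2, 1; rewrite ltr1n ltr01. Qed.

Lemma C2_ball_sub (g : Neg R) (l1 l2 e1 e2 : R) :
  1 < l1 -> l1 <= l2 -> e1 <= e2 -> C2_ball g l1 e1 `<=` C2_ball g l2 e2.
Proof.
move=> l1_gt1 l12 e12 h [/= hl he]; split; last first.
  by apply: lt_le_trans he _; rewrite lee_fin.
apply: lt_le_trans hl _; rewrite lee_fin ler_ln// posrE.
  exact: lt_trans l1_gt1.
by apply: lt_le_trans l12; exact: lt_trans l1_gt1.
Qed.

Lemma C2_openI : setI_closed C2_open.
Proof.
move=> U V oU oV g [Ug Vg].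
have [l1 [e1 [l1_gt1 e1_gt0 sU]]] := oU g Ug.
have [l2 [e2 [l2_gt1 e2_gt0 sV]]] := oV g Vg.
have l_gt1 : 1 < Num.min l1 l2 by rewrite lt_min l1_gt1.
exists (Num.min l1 l2), (Num.min e1 e2); split => //.
  by rewrite lt_min e1_gt0.
move=> h hgh; split; [apply: sU|apply: sV]; apply: C2_ball_sub hgh => //;
  by rewrite ge_min lexx ?orbT.
Qed.

Lemma C2_open_bigcup (I : Type) (f : I -> set (Neg R)) :
  (forall i, C2_open (f i)) -> C2_open (\bigcup_i f i).
Proof.
move=> of_ g [i _ fig]; have [l [e [l_gt1 e_gt0 sf]]] := of_ i g fig.
by exists l, e; split => // h /sf fih; exists i.
Qed.

End Topology.

HB.instance Definition _ (R : realType) :=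
  @isOpenTopological.Build (Neg R) C2_open C2_openT C2_openI C2_open_bigcup.

Section Moduli.
Context {R : realType}.

(* h = phi^* g; the differential of phi at [cylproj p] is that of any local lift
   of phi at p. *)
Definition is_pullback (phi : cylinder R -> cylinder R) (g h : form_field R) :
    Prop :=
  forall p F, local_lift phi p F -> forall v w,
    bilin (h (cylproj p)) v w =
    bilin (g (phi (cylproj p))) ('D_v F p) ('D_w F p).

Definition Diff_orbit (g : Neg R) : set (Neg R) :=
  [set h | exists2 phi, diffeomorphism phi & is_pullback phi g h].

End Moduli.

Record orbit_space (R : realType) := MkOrbit {
  orbit_set : set (Neg R);
  orbit_setP : exists g, Diff_orbit g = orbit_set
}.

Section OrbitQuotient.
Context {R : realType}.

Definition orbit_of (g : Neg R) : orbit_space R :=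
  MkOrbit (ex_intro _ g erefl).

Definition orbit_repr (O : orbit_space R) : Neg R :=
  projT1 (cid (orbit_setP O)).

Lemma orbit_reprK : cancel orbit_repr orbit_of.
Proof.
case=> O OP; rewrite /orbit_repr /orbit_of /=; case: cid => g gO /=.
by case: O / gO OP => OP; congr MkOrbit; exact: Prop_irrelevance.
Qed.

End OrbitQuotient.

HB.instance Definition _ (R : realType) :=
  @isQuotient.Build (Neg R) (orbit_space R) orbit_repr orbit_of orbit_reprK.

Definition moduli_space (R : realType) : topologicalType :=
  quotient_topology (orbit_space R).

(* Main.v *)
From HB Require Import structures.
Require Import Defs.
From mathcomp Require Import all_boot all_order all_algebra.
From mathcomp Require Import generic_quotient ring lra.
From mathcomp Require Import all_classical all_reals all_analysis.
From mathcomp Require Import measurable_realfun.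

Set Implicit Arguments.
Unset Strict Implicit.
Unset Printing Implicit Defensive.
Import Order.TTheory GRing.Theory Num.Theory.
Import numFieldNormedType.Exports.
Local Open Scope classical_set_scope.
Local Open Scope ring_scope.

(** Call a metric on the cylinder _pinched_ if its two ends can be separated by
    sets that are as small as one likes.  A hyperbolic cylinder with a cusp is
    pinched, because the horocircles around the cusp have lengths tending to 0.
    A hyperbolic cylinder with two funnels is not, because every curve that
    separates its ends is at least as long as the closed geodesic.  Pinching is
    a property of the bi-Lipschitz class of the metric: it survives both replacing
    a metric by one within a factor of 2 and pulling it back by a
    diffeomorphism.  Hence the pinched metrics form a set that is open and closed
    in the uniform topology and is a union of orbits.  Its image in the moduli
    space is open, closed, nonempty and not everything.

    The proof measures smallness by functions and not by curves: a set is small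
    if every function with gradient of norm at most 1 has small oscillation on
    it, and it reaches an end if some function with bounded gradient is unbounded
    on it.  Functions are pulled back by composition, so the invariance under
    diffeomorphisms ([pinched_pullback]) follows from the chain rule applied to
    local lifts, and no curve has to be lifted.  The invariance under a change
    by a factor of 2 is [pinched_quasi], and [moduli_space_disconnected] draws the
    topological conclusion.

    Both examples belong to the family dr^2 + (e^r + B e^-r)^2 dtheta^2 with
    B >= 0, in which the width w = e^r + B e^-r satisfies w'' = w, so that the
    curvature -w''/w is constant equal to -1.  For B = 0 the end r -> -oo is a
    cusp ([cusp_pinched]).  For B = 1 the width is bounded below and both ends
    are funnels ([funnel_not_pinched]). *)

(** * Calculus in the plane *)

Section Calculus.
Context {R : realType}.
Implicit Types (p q v w : 'rV[R]_2) (f : 'rV[R]_2 -> R).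

Definition pt (a b : R) : 'rV[R]_2 := a *: ebase 0 + b *: ebase 1.

Lemma pt0 a b : pt a b 0 0 = a.
Proof. by rewrite !mxE /= mulr1 mulr0 addr0. Qed.

Lemma pt1 a b : pt a b 0 1 = b.
Proof. by rewrite !mxE /= mulr1 mulr0 add0r. Qed.

Lemma ptE v : v = pt (v 0 0) (v 0 1).
Proof.
apply/rowP => i; rewrite !mxE; case: (unliftP 0 i) => [j ->|->] /=.
  rewrite !(ord1 j); rewrite (_ : lift 0 0 = 1 :> 'I_2); last exact/val_inj.
  by rewrite eqxx /= mulr1 mulr0 add0r.
by rewrite mulr1 mulr0 addr0.
Qed.

Lemma normr_coord_le v i : `|v 0 i| <= `|v|.
Proof.
rewrite [leRHS]/Num.Def.normr/= mx_normrE.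
exact: (le_bigmax _ (fun i : 'I_1 * 'I_2 => `|v i.1 i.2|) (0, i)).
Qed.

Lemma norm_pt_le a b c : `|a| <= c -> `|b| <= c -> `|pt a b| <= c.
Proof.
move=> ac bc; rewrite [leLHS]/Num.Def.normr/= mx_normrE.
apply: bigmax_le => [|[i j] _]; first exact: le_trans ac.
rewrite (ord1 i) /=; case: (unliftP 0 j) => [k ->|->]; last by rewrite pt0.
rewrite (ord1 k) (_ : lift 0 0 = 1 :> 'I_2) ?pt1//; exact/val_inj.
Qed.

Lemma is_derive_line (W : normedModType R) (F : 'rV[R]_2 -> W) p v (t : R) :
  derivable F (p + t *: v) v ->
  is_derive t 1 (fun s : R => F (p + s *: v)) ('D_v F (p + t *: v)).
Proof.
move=> dF.
have E : (fun h : R => h^-1 *: (((fun s : R => F (p + s *: v)) \o shift t) (h *: 1)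
    - F (p + t *: v))) =
  (fun h : R => h^-1 *: ((F \o shift (p + t *: v)) (h *: v) - F (p + t *: v))).
  by apply/funext => h /=; rewrite [h%:A]mulr1 scalerDl addrCA.
by split; rewrite /derivable /derive E.
Qed.

(** The sign of [b] is left free, so that the increments of a function of two
    variables can be estimated without distinguishing quadrants. *)
Lemma MVT_unordered (g dg : R -> R) (b : R) :
  (forall x : R, `|x| <= `|b| -> is_derive x 1 g (dg x)) ->
  exists2 c, `|c| <= `|b| & g b - g 0 = dg c * b.
Proof.
move=> dg'.
have cg c d : (forall x, x \in `[c, d] -> `|x| <= `|b|) ->
    {within `[c, d], continuous g}.
  move=> cd; apply: derivable_within_continuous => x /cd xb.
  by have [] := dg' x xb.
have [b0|b0] := leP 0 b.
  have H x : x \in `[0, b] -> `|x| <= `|b|.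
    by rewrite in_itv/= => /andP[x0 xb]; rewrite !ger0_norm.
  have [c /H cb E] := MVT_segment b0
     (fun x xb => dg' x (H x (subset_itv_oo_cc xb))) (cg _ _ H).
  by exists c => //; rewrite E subr0.
have H x : x \in `[b, 0] -> `|x| <= `|b|.
  rewrite in_itv/= => /andP[x0 xb]; rewrite !ler0_norm ?lerN2//; exact: ltW.
have [c /H cb E] := MVT_segment (ltW b0)
   (fun x xb => dg' x (H x (subset_itv_oo_cc xb))) (cg _ _ H).
by exists c => //; rewrite -opprB E sub0r mulrN opprK.
Qed.

(** Continuous partial derivatives give a total derivative: the increment is
    split along the two axes, and the mean value theorem on each piece compares
    it with the partial derivatives at [p]. *)
Lemma C1_differentiable f (U : set 'rV[R]_2) p :
  open_nbhs p U -> Ck_on U 1 (f : 'rV[R]_2 -> R^o) ->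
  differentiable (f : 'rV[R]_2 -> R^o) p.
Proof.
move=> [oU Up] [_ Cf].
pose d i : 'rV[R]_2 -> R := 'D_(ebase i) (f : 'rV[R]_2 -> R^o).
pose L v : R^o := v 0 0 * d 0 p + v 0 1 * d 1 p.
have L_lin : linear L.
  move=> a u v; rewrite /L !mxE /GRing.scale /=; ring.
pose LM := GRing.isLinear.Build _ _ _ _ _ L_lin.
pose LL : {linear 'rV[R]_2 -> R^o} := HB.pack L LM.
have cL : continuous LL.
  move=> v; rewrite /LL /= /L.
  apply: (@continuousD _ R^o _ (fun v => v 0 0 * d 0 p) (fun v => v 0 1 * d 1 p));
    apply: (@continuousM R _ (fun v => v 0 _) (cst _));
    by [exact: coord_continuous|exact: cst_continuous].
suff E : forall e : R, 0 < e -> \forall v \near (0 : 'rV[R]_2),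
    `|f (v + p) - (f p + L v)| <= e * `|v|.
  have dE : 'd (f : 'rV[R]_2 -> R^o) p = LL :> (_ -> _).
    by apply: diff_unique => //; apply/eqaddoP.
  by apply/diff_locallyP; rewrite dE; split => //; apply/eqaddoP.
move=> _/posnumP[e].
have dc i : \forall q \near p, `|d i p - d i q| < e%:num / 2.
  have [_ [/(_ _ Up) + _]] := Cf i.
  by move/cvgrPdist_lt => /(_ (e%:num / 2) ltac:(by [])).
have Un : \forall q \near p, U q by exact: open_nbhs_nbhs.
have /nbhs_ballP[r /= r0 Hr] : \forall q \near p,
   [/\ U q, `|d 0 p - d 0 q| < e%:num / 2 & `|d 1 p - d 1 q| < e%:num / 2].
  by apply: filterS3 Un (dc 0) (dc 1) => q.
apply/nbhs_ballP; exists r => //= v; rewrite -ball_normE /= sub0r normrN => vr.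
have Hv a b : `|a| <= `|v| -> `|b| <= `|v| ->
   [/\ U (p + pt a b), `|d 0 p - d 0 (p + pt a b)| < e%:num / 2
     & `|d 1 p - d 1 (p + pt a b)| < e%:num / 2].
  move=> av bv; apply: Hr; rewrite -ball_normE /= opprD addrA subrr sub0r normrN.
  by apply: le_lt_trans vr; exact: norm_pt_le.
have v0 := normr_coord_le v 0; have v1 := normr_coord_le v 1.
have D0 (x : R) : `|x| <= `|v 0 0| ->
    is_derive x 1 (fun s => f (p + s *: ebase 0) : R^o) (d 0 (p + x *: ebase 0)).
  move=> xv; apply: is_derive_line.
  have [] := Hv x 0 (le_trans xv v0) ltac:(by rewrite normr0).
  by rewrite /pt scale0r addr0 => Ux _ _; have [/(_ _ Ux)] := Cf 0.
have D1 (x : R) : `|x| <= `|v 0 1| ->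
    is_derive x 1 (fun s => f (p + v 0 0 *: ebase 0 + s *: ebase 1) : R^o)
      (d 1 (p + v 0 0 *: ebase 0 + x *: ebase 1)).
  move=> xv; apply: is_derive_line.
  have [] := Hv (v 0 0) x v0 (le_trans xv v1).
  by rewrite /pt addrA => Ux _ _; have [/(_ _ Ux)] := Cf 1.
have [c0 c0v E0] := MVT_unordered D0.
have [c1 c1v E1] := MVT_unordered D1.
have [_ H0 _] := Hv c0 0 (le_trans c0v v0) ltac:(by rewrite normr0).
have [_ _ H1] := Hv (v 0 0) c1 v0 (le_trans c1v v1).
rewrite /pt !scale0r !addr0 in H0; rewrite /pt addrA in H1.
rewrite scale0r addr0 in E0; rewrite scale0r addr0 in E1.
move: H0 H1 E0 E1; move: (d 0 (p + _)) (d 1 (p + _ + _)) => D0' D1' H0 H1 E0 E1.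
have E2 : f (v + p) - (f p + (v 0 0 * d 0 p + v 0 1 * d 1 p)) =
    v 0 0 * (D0' - d 0 p) + v 0 1 * (D1' - d 1 p) .
  have -> : f (v + p) - (f p + (v 0 0 * d 0 p + v 0 1 * d 1 p)) =
      (f (p + v) - f (p + v 0 0 *: ebase 0))
      + (f (p + v 0 0 *: ebase 0) - f p) - (v 0 0 * d 0 p + v 0 1 * d 1 p).
    by rewrite subrKA -addrA -opprD [p + v]addrC.
  have -> : p + v = p + v 0 0 *: ebase 0 + v 0 1 *: ebase 1.
    by rewrite -addrA -/(pt _ _) -ptE.
  rewrite E1 E0; ring.
rewrite E2.
apply: (le_trans (ler_normD (v 0 0 * (D0' - d 0 p) : R) (v 0 1 * (D1' - d 1 p)))).
rewrite !normrM /=.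
rewrite (distrC D0') (distrC D1').
apply: (@le_trans _ _ (`|v| * (e%:num / 2) + `|v| * (e%:num / 2))).
  by apply: lerD; apply: ler_pM => //; exact: ltW.
by rewrite -mulrDr -splitr mulrC.
Qed.

Lemma differentiable_coord_comp (phi : R -> R) p i :
  derivable (phi : R -> R^o) (p 0 i) 1 ->
  differentiable (fun q => phi (q 0 i) : R^o) p.
Proof.
move=> /derivable1_diffP dphi.
exact: (differentiable_comp (differentiable_coord p 0 i) dphi).
Qed.

Lemma is_derive_coord_comp (phi : R -> R) p v i (d : R) :
  is_derive (p 0 i) 1 (phi : R -> R^o) d ->
  is_derive p v (fun q => phi (q 0 i) : R^o) (v 0 i * d).
Proof.
move=> [dphi dE]; have D := differentiable_coord_comp dphi.
split; first exact: diff_derivable.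
have cE : 'd (fun q : 'rV[R]_2 => q 0 i : R^o) p v = v 0 i.
  rewrite -deriveE; last exact: differentiable_coord.
  have := derive_mx (@derivable_id _ _ p v).
  by rewrite derive_id => /matrixP /(_ 0 i); rewrite mxE.
rewrite deriveE//.
have dphi' : differentiable (phi : R -> R^o) (p 0 i) by exact/derivable1_diffP.
rewrite (_ : 'd _ p v = ('d (phi : R -> R^o) (p 0 i) \o
   'd (fun q : 'rV[R]_2 => q 0 i : R^o) p) v); last first.
  by rewrite -(diff_comp (differentiable_coord p 0 i) dphi').
by rewrite /= cE diff1E// derive1E dE.
Qed.

End Calculus.

(** * Local lifts *)

Lemma near_eq_differentiable {R : numFieldType} (V W : normedModType R)
    (f g : V -> W) (a : V) :
  (\forall x \near a, f x = g x) -> differentiable f a -> differentiable g a.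
Proof.
move=> fg df; have [cd /eqaddoP fd] := (diff_locallyP _ _).1 df.
have fg0 : \forall x \near (0 : V), f (x + a) = g (x + a).
  by move: fg; rewrite (near_shift 0 a) /= subr0.
have gd (e : R) : 0 < e ->
    \forall x \near (0 : V), `|g (x + a) - (g a + 'd f a x)| <= e * `|x|.
  move=> /fd; apply: filterS2 fg0 => x <-.
  by rewrite -(nbhs_singleton fg).
have dE : 'd g a = 'd f a :> (V -> W).
  by apply: diff_unique => //; apply/eqaddoP.
by apply/diff_locallyP; rewrite dE; split => //; apply/eqaddoP.
Qed.

Section LocalLifts.
Context {R : realType}.
Implicit Types (p q v w : 'rV[R]_2) (F G : 'rV[R]_2 -> 'rV[R]_2).

Lemma circle_eqP (s t : R) :
  \pi_(circle R)%qT s = \pi_(circle R)%qT t <-> s - t \is a Num.int.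
Proof. by split=> [/eqmodP|st]; [|apply/eqmodP]. Qed.

Lemma cylproj_eqP p q :
  cylproj p = cylproj q <-> p 0 0 = q 0 0 /\ p 0 1 - q 0 1 \is a Num.int.
Proof.
by split=> [[-> /circle_eqP]//|[e /circle_eqP e']]; rewrite /cylproj e e'.
Qed.

Lemma cylproj_surj (x : cylinder R) : exists p, cylproj p = x.
Proof.
exists (pt x.1 (repr x.2)); rewrite /cylproj pt0 pt1 reprK.
by case: x.
Qed.

Lemma int_norm_lt1 (x : R) : x \is a Num.int -> `|x| < 1 -> x = 0.
Proof.
by move=> xi; apply: contraTeq => x0; rewrite -leNgt norm_intr_ge1.
Qed.

(** Two lifts of one map differ in the angular coordinate by an integer, and a
    continuous integer-valued function is locally constant. *)
Lemma lifts_differ_by_constant F G p :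
  {for p, continuous F} -> {for p, continuous G} ->
  (\forall q \near p, cylproj (F q) = cylproj (G q)) ->
  \forall q \near p, F q = G q + (F p - G p).
Proof.
move=> cF cG FG.
have /cylproj_eqP[FGp0 FGp1] := nbhs_singleton FG.
have nF : \forall q \near p, `|F p - F q| < 2^-1.
  by move/cvgrPdist_lt : cF; apply; rewrite invr_gt0.
have nG : \forall q \near p, `|G p - G q| < 2^-1.
  by move/cvgrPdist_lt : cG; apply; rewrite invr_gt0.
apply: filterS3 FG nF nG => q /cylproj_eqP[FG0 FG1] Fq Gq.
have E1 : (F q 0 1 - G q 0 1) - (F p 0 1 - G p 0 1) = 0.
  apply: int_norm_lt1; first by rewrite rpredB.
  have -> : F q 0 1 - G q 0 1 - (F p 0 1 - G p 0 1) =
     (G p - G q) 0 1 - (F p - F q) 0 1 by rewrite !mxE; ring.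
  rewrite (le_lt_trans (ler_normB _ _))// [ltRHS]splitr div1r addrC ltrD//;
    by apply: le_lt_trans (normr_coord_le _ _) _.
apply/subr0_eq; rewrite [LHS]ptE !mxE FGp0 FG0 subrr addr0 subrr.
have -> : F q 0 1 - (G q 0 1 + (F p 0 1 - G p 0 1)) = 0 by rewrite -E1; ring.
by rewrite /pt !scale0r addr0.
Qed.

(** This is what makes the differential of a map of the cylinder independent
    of the chosen lift. *)
Lemma lifts_same_derivative F G p v :
  differentiable F p -> differentiable G p ->
  (\forall q \near p, cylproj (F q) = cylproj (G q)) ->
  'D_v F p = 'D_v G p.
Proof.
move=> dF dG FG.
rewrite (near_eq_derive _ (lifts_differ_by_constant (differentiable_continuous dF)
  (differentiable_continuous dG) FG)).
rewrite (_ : (fun q => _) = G + cst (F p - G p))//.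
rewrite deriveD ?derive_cst ?addr0//; exact: diff_derivable.
Qed.

Lemma differentiable_rV2 F p :
  differentiable (fun q => F q 0 0 : R^o) p ->
  differentiable (fun q => F q 0 1 : R^o) p ->
  differentiable F p.
Proof.
move=> d0 d1.
have -> : F = (fun q => F q 0 0 *: ebase 0) + (fun q => F q 0 1 *: ebase 1).
  by apply/funext => q; exact: ptE.
by apply: differentiableD; [exact: (differentiableZl (ebase 0) d0)|
  exact: (differentiableZl (ebase 1) d1)].
Qed.

Lemma C1_coord (U : set 'rV[R]_2) F i :
  open U -> Ck_on U 1 F -> Ck_on U 1 (fun q => F q 0 i : R^o).
Proof.
move=> oU [cF dF].
have coordc (H : 'rV[R]_2 -> 'rV[R]_2) p : {for p, continuous H} ->
    {for p, continuous (fun q => H q 0 i : R^o)}.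
  move=> cH; apply: (@continuous_comp _ _ _ H (fun M => M 0 i : R^o) p cH).
  exact: coord_continuous.
split=> [p Up|j]; first exact/coordc/cF.
have [dj [cj _]] := dF j; split => [p Up|].
  by have /derivable_mxP := dj p Up; exact.
split=> // p Up.
have E : \forall q \near p, 'D_(ebase j) F q 0 i =
    'D_(ebase j) (fun q => F q 0 i : R^o) q.
  have : \forall q \near p, U q by exact: open_nbhs_nbhs.
  by apply: filterS => q Uq; rewrite (derive_mx (dj q Uq)) mxE.
have := coordc _ _ (cj p Up).
have /= Ep := nbhs_singleton E.
rewrite /prop_for /continuous_at /= Ep; apply: cvg_trans.
apply: (@near_eq_cvg _ _ (nbhs p) (nbhs_filter p)).
by apply: filterS E => q ->.
Qed.

Lemma local_lift_differentiable phi p F : local_lift phi p F ->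
  differentiable F p /\ \forall q \near p, cylproj (F q) = phi (cylproj q).
Proof.
move=> [U [[oU Up] sF HF]]; split.
  by apply: differentiable_rV2; apply: (C1_differentiable (U := U)) => //;
    apply: C1_coord => //; exact: sF.
have : \forall q \near p, U q by exact: open_nbhs_nbhs.
by apply: filterS.
Qed.

End LocalLifts.

(** * Pinched metrics *)

Section Pinching.
Context {R : realType}.
Implicit Types (p q v w : 'rV[R]_2) (g h : form_field R) (f : cylinder R -> R)
  (A : set (cylinder R)).

(** The condition |grad f|^2 <= C for the metric [g], written by duality so that
    the inverse of the Gram matrix does not occur. *)
Definition grad_bounded g (C : R) f := forall p,
  differentiable (f \o @cylproj R : 'rV[R]_2 -> R^o) p /\
  forall v, ('D_v (f \o @cylproj R : 'rV[R]_2 -> R^o) p : R) ^+ 2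
            <= C * bilin (g (cylproj p)) v v.

(** The topological frontier, tested in the plane because the projection onto
    the cylinder is a local homeomorphism. *)
Definition frontier A : set (cylinder R) := [set x | exists2 p, cylproj p = x &
  ~ \forall q \near p, A (cylproj q) <-> A (cylproj p)].

Definition far_reaching g A := exists C f, grad_bounded g C f /\
  forall M : R, exists2 x, A x & M < `|f x|.

(** The frontier of [A] is the small separating set, and [A] and its complement
    contain the two ends that it separates.  This stands for the existence of
    arbitrarily short loops around the cylinder. *)
Definition pinched g := forall e : R, 0 < e -> exists A,
  [/\ forall f, grad_bounded g 1 f -> forall x y, frontier A x -> frontier A y ->
        `|f x - f y| <= e,
      far_reaching g A & far_reaching g (~` A)].

Lemma grad_bounded_quasi g h C f : 0 <= C ->
  (forall x v, bilin (g x) v v <= 2 * bilin (h x) v v) ->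
  grad_bounded g C f -> grad_bounded h (C * 2) f.
Proof.
move=> C0 gh gf p; have [df Df] := gf p; split=> // v.
by apply: le_trans (Df v) _; rewrite -mulrA ler_wpM2l.
Qed.

Lemma grad_bounded_weaken g C C' f : (forall x v, 0 <= bilin (g x) v v) ->
  C <= C' -> grad_bounded g C f -> grad_bounded g C' f.
Proof.
move=> g0 CC gf p; have [df Df] := gf p; split=> // v.
by apply: le_trans (Df v) _; rewrite ler_wpM2r.
Qed.

Lemma grad_bounded_scale g C (c : R) f :
  grad_bounded g C f -> grad_bounded g (c ^+ 2 * C) (fun x => c * f x).
Proof.
move=> gf p; have [df Df] := gf p.
have E : (fun x => c * f x) \o @cylproj R =
  c \*: (f \o @cylproj R : 'rV[R]_2 -> R^o) by [].
split=> [|v]; rewrite E; first exact: differentiableZ.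
rewrite deriveZ; last exact: diff_derivable.
by rewrite [_ *: _]/(_ * _) exprMn -mulrA ler_wpM2l// sqr_ge0.
Qed.

(** Halving a function whose gradient has norm at most 1 for [h] gives one with
    this property for [g], so oscillations double at worst; [pinched] quantifies
    over all [e], which absorbs the factor. *)
Lemma pinched_quasi g h :
  (forall x v, 0 <= bilin (g x) v v) ->
  (forall x v, bilin (g x) v v <= 2 * bilin (h x) v v) ->
  (forall x v, bilin (h x) v v <= 2 * bilin (g x) v v) ->
  pinched g -> pinched h.
Proof.
move=> g0 gh hg Pg e e0.
have far A : far_reaching g A -> far_reaching h A.
  move=> [C [f [gf uf]]]; exists (`|C| * 2), f; split=> //.
  apply: grad_bounded_quasi gh _ => //.
  exact: grad_bounded_weaken g0 (ler_norm _) gf.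
have [A [Ae A1 A2]] := Pg (e / 2) ltac:(by rewrite divr_gt0).
exists A; split; [|exact: far..] => f hf x y Ax Ay.
have : grad_bounded g 1 (fun x => 2^-1 * f x).
  apply: (@grad_bounded_weaken _ ((2^-1) ^+ 2 * (1 * 2))) => //.
    by rewrite mul1r expr2 -mulrA mulVf// mulr1 invf_le1// ler1n.
  by apply: grad_bounded_scale; exact: grad_bounded_quasi hg hf.
move=> /Ae /(_ x y Ax Ay); rewrite -mulrBr normrM ger0_norm ?invr_ge0//.
by rewrite mulrC ler_pM2r ?invr_gt0.
Qed.

Section Pullback.
Variables (phi psi : cylinder R -> cylinder R) (g h : form_field R).
Hypotheses (phi_smooth : smooth_map phi) (psi_smooth : smooth_map psi)
  (phiK : cancel phi psi) (psiK : cancel psi phi)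
  (gh : is_pullback phi g h).

(** Chain rule, for a map [chi] that pulls [g'] back to [h']. *)
Lemma grad_bounded_comp g' h' (chi : cylinder R -> cylinder R) C f :
  (forall p, exists2 F, local_lift chi p F & forall v,
     bilin (h' (cylproj p)) v v =
     bilin (g' (chi (cylproj p))) ('D_v F p) ('D_v F p)) ->
  grad_bounded g' C f -> grad_bounded h' C (f \o chi).
Proof.
move=> H gf p; have [F /[dup] /local_lift_differentiable [dF HF] _ E] := H p.
have [df Df] := gf (F p).
have fE : \forall q \near p, (f \o @cylproj R \o F) q =
    ((f \o chi) \o @cylproj R) q :> R^o.
  by apply: filterS HF => q /= ->.
have dc := differentiable_comp dF df.
split.
  exact: (near_eq_differentiable fE).
move=> v; rewrite -(near_eq_derive v fE) deriveE// diff_comp//= -!deriveE//.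
by apply: le_trans (Df _) _; rewrite (nbhs_singleton HF) E.
Qed.

Lemma grad_bounded_pullback C f :
  grad_bounded g C f -> grad_bounded h C (f \o phi).
Proof.
apply: grad_bounded_comp => p; have [F pF] := phi_smooth p.
by exists F => // v; exact: gh.
Qed.

(** The inverse of [phi] pulls [h] back to [g]: composing lifts of [psi] and
    [phi] gives a lift of the identity, whose derivative is the identity. *)
Lemma grad_bounded_pushforward C f :
  grad_bounded h C f -> grad_bounded g C (f \o psi).
Proof.
apply: grad_bounded_comp => p; have [G pG] := psi_smooth p.
exists G => // v; have [F pF] := phi_smooth (G p).
have [dG HG] := local_lift_differentiable pG.
have [dF HF] := local_lift_differentiable pF.
rewrite -(nbhs_singleton HG) (gh pF) (nbhs_singleton HG) psiK.
suff -> : 'D_('D_v G p) F (G p) = v by [].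
rewrite !deriveE// -[LHS]/(('d F (G p) \o 'd G p) v) -diff_comp// -deriveE//.
  rewrite -[RHS](derive_id p v); apply: lifts_same_derivative => //.
    exact: differentiable_comp.
  have := (differentiable_continuous dG : G @ p --> G p) _ HF.
  apply: filterS2 HG => q /= E1 E2; by rewrite E2 E1 psiK.
exact: differentiable_comp.
Qed.

Lemma frontier_preimage A : frontier (phi @^-1` A) `<=` phi @^-1` frontier A.
Proof.
move=> _ [p <- pA]; have [F pF] := phi_smooth p.
have [dF HF] := local_lift_differentiable pF.
have Fp := nbhs_singleton HF; exists (F p) => //.
apply: contra_not pA => H.
have := (differentiable_continuous dF : F @ p --> F p) _ H.
by apply: filterS2 HF => q /= <-; rewrite Fp.
Qed.

Lemma pinched_pullback : pinched g -> pinched h.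
Proof.
move=> Pg e /Pg[A [Ae A1 A2]]; exists (phi @^-1` A).
have far B : far_reaching g B -> far_reaching h (phi @^-1` B).
  move=> [C [f [gf uf]]]; exists C, (f \o phi).
  split=> [|M]; first exact: grad_bounded_pullback.
  by have [x Bx Mx] := uf M; exists (psi x) => /=; rewrite psiK.
split; [|exact: far|exact: (far (~` A))] => f hf x y Ax Ay.
have := Ae _ (grad_bounded_pushforward hf) (phi x) (phi y)
  (frontier_preimage Ax) (frontier_preimage Ay).
by rewrite /= !phiK.
Qed.

End Pullback.
End Pinching.

(** * The pinched metrics are open, closed and a union of orbits *)

Section Clopen.
Context {R : realType}.
Implicit Types g h : Neg R.

Lemma bilin_ge0 g x v : 0 <= bilin (neg_form g x) v v.
Proof.
have [->|v0] := eqVneq v 0; first by rewrite /bilin trmx0 mulmx0 mxE.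
by have [_ _ gp] := neg_riemannian g; exact/ltW/gp.
Qed.

(** Log-distortion less than [ln 2] means that the two metrics agree up to a
    factor of 2. *)
Lemma C2_ball_quasi g h x v : C2_ball g 2 1 h ->
  bilin (neg_form g x) v v <= 2 * bilin (neg_form h x) v v /\
  bilin (neg_form h x) v v <= 2 * bilin (neg_form g x) v v.
Proof.
move=> [gh _].
have [->|v0] := eqVneq v 0.
  by rewrite /bilin trmx0 !mulmx0 !mxE mulr0.
have [_ _ /(_ x v v0) gp] := neg_riemannian g.
have [_ _ /(_ x v v0) hp] := neg_riemannian h.
set a := bilin _ v v in gp *; set b := bilin _ v v in hp *.
have : `|ln (b / a)| < ln 2.
  rewrite -lte_fin; apply: le_lt_trans gh; rewrite /log_distortion.
  apply: le_trans; last by apply: ereal_sup_ubound; exists x.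
  by apply: ereal_sup_ubound; exists v.
rewrite ltr_norml -lnV ?posrE// !ltr_ln ?posrE ?invr_gt0 ?divr_gt0// => /andP[].
rewrite ltr_pdivlMr// ltr_pdivrMr// => l1 l2; split; last exact: ltW.
by rewrite -ler_pdivrMl// ltW.
Qed.

Lemma pinched_open : open [set g : Neg R | pinched g].
Proof.
move=> g Pg; exists 2, 1; split; rewrite ?ltr1n// => h gh.
by apply: (pinched_quasi (bilin_ge0 g)) Pg => x v; have [] := C2_ball_quasi x v gh.
Qed.

Lemma pinched_closed : open (~` [set g : Neg R | pinched g]).
Proof.
move=> g Pg; exists 2, 1; split; rewrite ?ltr1n// => h gh Ph; apply: Pg.
by apply: (pinched_quasi (bilin_ge0 h)) Ph => x v; have [] := C2_ball_quasi x v gh.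
Qed.

Lemma is_pullback_id (g : form_field R) : is_pullback id g g.
Proof.
move=> p F pF v w; have [dF HF] := local_lift_differentiable pF.
have DF u : 'D_u F p = u.
  by rewrite -[RHS](derive_id p u); apply: lifts_same_derivative.
by rewrite !DF.
Qed.

Lemma smooth_map_id : smooth_map (@id (cylinder R)).
Proof.
move=> p; exists id; exists setT; split=> //.
- by split => //; exact: openT.
- suff H n (c : 'rV[R]_2) : Ck_on setT n (cst c).
    have idc q : {for q, continuous (@id 'rV[R]_2)} by move=> ?; exact.
    case=> [|n]; split => //.
      move=> i; split=> [q _|]; first exact: derivable_id.
      rewrite (_ : 'D__ _ = cst (ebase i)); first exact: H.
      by apply/funext => q; rewrite derive_id.
  have cstc q (d : 'rV[R]_2) : {for q, continuous (cst d : 'rV[R]_2 -> _)}.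
    by move: q; exact: cst_continuous.
  elim: n c => [|n IHn] c; split=> // i.
  split=> [q _|]; first exact: derivable_cst.
  rewrite (_ : 'D__ _ = cst 0); first exact: IHn.
  by apply/funext => q; rewrite derive_cst.
Qed.

Lemma Diff_orbit_refl g : Diff_orbit g g.
Proof.
exists id; last exact: is_pullback_id.
by split; [exact: smooth_map_id|exists id; split => //; exact: smooth_map_id].
Qed.

Lemma pinched_orbit g h : Diff_orbit g h -> pinched g -> pinched h.
Proof.
by move=> [phi [sphi [psi [spsi phiK psiK]]] gh]; exact: (pinched_pullback sphi spsi).
Qed.

(** Pinching does not depend on the representative of an orbit, because both
    representatives lie in the orbit of each other. *)
Lemma pinched_repr g : pinched (repr (\pi_(moduli_space R) g)%qT) <-> pinched g.
Proof.
set g' := repr _.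
have /(congr1 (@orbit_set R)) /= E : orbit_of g' = orbit_of g.
  by have := @reprK _ (moduli_space R) (\pi_(moduli_space R) g)%qT; rewrite /g' !unlock.
split; apply: pinched_orbit.
  by rewrite E; exact: Diff_orbit_refl.
by rewrite -E; exact: Diff_orbit_refl.
Qed.

Lemma moduli_space_disconnected : (exists g : Neg R, pinched g) ->
  (exists g : Neg R, ~ pinched g) -> ~ connected [set: moduli_space R].
Proof.
move=> [g Pg] [h nPh] conn.
pose B : set (moduli_space R) := [set O : moduli_space R | pinched (repr O : Neg R)].
have preB : (\pi_(moduli_space R)%qT) @^-1` B = [set g : Neg R | pinched g].
  by apply/seteqP; split => k /=; rewrite /B /= pinched_repr.
have /seteqP[_ /(_ (\pi_(moduli_space R) h)%qT I)] : B = [set: moduli_space R];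
  last by move/pinched_repr.
apply: conn.
- by exists (\pi_(moduli_space R) g)%qT; apply/pinched_repr.
- exists B; last by rewrite setTI.
  have : open (\pi_(moduli_space R)%qT @^-1` B) by rewrite preB; exact: pinched_open.
  exact.
- exists B; last by rewrite setTI.
  rewrite -openC.
  have : open (\pi_(moduli_space R)%qT @^-1` (~` B)).
    rewrite (_ : _ @^-1` _ = ~` [set g : Neg R | pinched g]); last by rewrite -preB.
    exact: pinched_closed.
  exact.
Qed.

End Clopen.

(** * Warped products of constant curvature -1 *)

Section Warped.
Context {R : realType}.
Variable B : R.
Hypothesis B0 : 0 <= B.
Implicit Types (p q v : 'rV[R]_2) (r t : R).

(** Circumference of the circle at height [r].  It is the solution of w'' = w
    that decays to 0 as r -> -oo when [B = 0], and that has a positive minimum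
    when [B > 0]. *)
Definition width r : R := expR r + B * expR (- r).

Definition warped : form_field R := fun x =>
  \matrix_(i, j) ((i == j)%:R * (if i == 0 then 1 else width x.1 ^+ 2)).

Lemma width_gt0 r : 0 < width r.
Proof. by rewrite ltr_wpDr ?expR_gt0// mulr_ge0// expR_ge0. Qed.

Lemma bilin_warped x v :
  bilin (warped x) v v = v 0 0 ^+ 2 + width x.1 ^+ 2 * v 0 1 ^+ 2.
Proof.
rewrite /bilin mxE !big_ord_recl big_ord0 !mxE !big_ord_recl !big_ord0 !mxE /=.
have -> : lift ord0 ord0 = 1 :> 'I_2 by exact/val_inj.
rewrite /=; ring.
Qed.

(** A space of functions that contains the squares of the widths and is stable
    under differentiation, on which the smoothness of all orders is proved by a
    single induction. *)
Definition exp2_comb (a b c : R) r : R := a * expR r ^+ 2 + b + c * expR (- r) ^+ 2.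

Lemma is_derive_exp2_comb a b c (r : R) :
  is_derive r 1 (exp2_comb a b c) (exp2_comb (2 * a) 0 (- 2 * c) r).
Proof.
rewrite /exp2_comb; apply: is_derive_eq.
by rewrite /GRing.scale /=; ring.
Qed.

Lemma exp2_combZ k a c r :
  k * exp2_comb a 0 c r = exp2_comb (k * a) 0 (k * c) r.
Proof. by rewrite /exp2_comb; ring. Qed.

Lemma width_sqr r : width r ^+ 2 = exp2_comb 1 (2 * B) (B ^+ 2) r.
Proof.
have := expRxMexpNx_1 r; rewrite /width /exp2_comb.
move: (expR r) (expR (- r)) => e f ef.
have -> : 2 * B = 2 * B * (e * f) by rewrite ef mulr1.
ring.
Qed.

Lemma exp2_comb_Ck n a b c :
  Ck_on setT n (fun p => exp2_comb a b c (p 0 0) : R^o).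
Proof.
elim: n a b c => [|n IHn] a b c; split=> //.
- move=> p _; apply: differentiable_continuous; apply: differentiable_coord_comp.
  by have [] := is_derive_exp2_comb a b c (p 0 0).
- move=> p _; apply: differentiable_continuous; apply: differentiable_coord_comp.
  by have [] := is_derive_exp2_comb a b c (p 0 0).
move=> i.
have D p := is_derive_coord_comp (ebase i) (is_derive_exp2_comb a b c (p 0 0)).
split=> [p _|]; first by have [] := D p.
have -> : 'D_(ebase i) (fun p => exp2_comb a b c (p 0 0) : R^o) =
   (fun p => exp2_comb (ebase i 0 0 * (2 * a)) 0 (ebase i 0 0 * (- 2 * c)) (p 0 0)).
  apply/funext => p; have [_ ->] := D p; exact: exp2_combZ.
exact: IHn.
Qed.

Lemma warped_riemannian : riemannian warped.
Proof.
split=> [i j|x|x v v0].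
- move=> n.
  have -> : (fun p => warped (cylproj p) i j : R^o) = fun p =>
     exp2_comb ((i == j)%:R * (i != 0)%:R) ((i == j)%:R * (if i == 0 then 1 else 2 * B))
       ((i == j)%:R * (if i == 0 then 0 else B ^+ 2)) (p 0 0).
    apply/funext => p; rewrite mxE /= width_sqr /exp2_comb.
    by case: (i == 0); rewrite /= ?mulr0 ?mulr1 ?mul0r ?addr0 ?add0r//;
      rewrite !mulrDr !mulrA ?mulr1.
  exact: exp2_comb_Ck.
- apply/matrixP => i j; rewrite !mxE eq_sym.
  by have [->|] := eqVneq i j; rewrite ?mul0r.
- rewrite bilin_warped; have w0 := exprn_gt0 2 (width_gt0 x.1).
  have [v00|v00] := eqVneq (v 0 0) 0.
    have v10 : v 0 1 != 0.
      by apply: contraNneq v0 => v10; rewrite [v]ptE v00 v10 /pt !scale0r addr0.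
    rewrite v00 expr0n /= add0r mulr_gt0//.
    by rewrite lt0r sqrf_eq0 v10 sqr_ge0.
  rewrite ltr_wpDr//; last by rewrite lt0r sqrf_eq0 v00 sqr_ge0.
  by rewrite mulr_ge0// ?sqr_ge0// ltW.
Qed.

Definition slope r : R := expR r - B * expR (- r).

Lemma is_derive_width (r : R) : is_derive r 1 width (slope r).
Proof.
rewrite /width /slope; apply: is_derive_eq; rewrite /GRing.scale /=; ring.
Qed.

Lemma is_derive_slope (r : R) : is_derive r 1 slope (width r).
Proof.
rewrite /width /slope; apply: is_derive_eq; rewrite /GRing.scale /=; ring.
Qed.

Lemma partial_radial i phi (d : R) p : is_derive (p 0 0) 1 (phi : R -> R^o) d ->
  partial i (fun q => phi (q 0 0)) p = (i == 0)%:R * d.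
Proof.
move=> /(is_derive_coord_comp (ebase i)) [_]; rewrite /partial => ->.
by rewrite mxE eq_sym.
Qed.

Lemma cometric_warped p i j : cometric warped p i j =
  (i == j)%:R * (if i == 0 then 1 else width (p 0 0) ^- 2).
Proof.
pose C : 'M[R]_2 :=
  \matrix_(i, j) ((i == j)%:R * (if i == 0 then 1 else width (p 0 0) ^- 2)).
have w0 := lt0r_neq0 (width_gt0 (p 0 0)).
have mC : metric warped p *m C = 1%:M.
  apply/matrixP => k l; rewrite !mxE (bigD1 k) //= big1 => [|m mk].
    rewrite !mxE eqxx /= mul1r addr0 mulrCA; case: (k == 0); rewrite ?mulr1//.
    by rewrite divff ?mulr1// expf_neq0.
  by rewrite !mxE eq_sym (negbTE mk) !mul0r.
have [u _] := mulmx1_unit mC.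
by rewrite /cometric -[invmx _]mulmx1 -mC mulKmx// mxE.
Qed.

Lemma partial_metric_warped i j k p : partial i (fun q => metric warped q j k) p =
  ((i == 0) && (j == 1) && (k == 1))%:R * (2 * width (p 0 0) * slope (p 0 0)).
Proof.
have -> : (fun q => metric warped q j k) = (fun q =>
    (fun r => (j == k)%:R * (if j == 0 then 1 else width r ^+ 2)) (q 0 0)).
  by apply/funext => q; rewrite !mxE.
have dw := is_derive_width (p 0 0).
have D : is_derive (p 0 0) 1
   ((fun r => (j == k)%:R * (if j == 0 then 1 else width r ^+ 2)) : R -> R^o)
   (((j == 1) && (k == 1))%:R * (2 * width (p 0 0) * slope (p 0 0))).
  have [->|j0] := eqVneq j 0.
    by rewrite /= mul0r; exact: is_derive_cst.
  have -> : j = 1 by apply/val_inj; case: j j0 => -[|[|]].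
  rewrite eqxx eq_sym /=; apply: is_derive_eq.
  by rewrite /GRing.scale /=; ring.
by rewrite (partial_radial i D) mulrA -natrM mulnb andbA.
Qed.

Lemma christoffel_warped k i j p : christoffel warped k i j p =
  2^-1 * (if k == 0 then 1 else width (p 0 0) ^- 2) *
  (((i == 0) && (j == 1) && (k == 1))%:R + ((j == 0) && (i == 1) && (k == 1))%:R
   - ((k == 0) && (i == 1) && (j == 1))%:R) * (2 * width (p 0 0) * slope (p 0 0)).
Proof.
rewrite /christoffel (bigD1 k)//= big1 => [|l lk]; last first.
  by rewrite cometric_warped eq_sym (negbTE lk) !mul0r.
rewrite !partial_metric_warped cometric_warped eqxx addr0 mul1r.
move: (_ && _)%:R => a; move: (_ && _)%:R => b; move: (_ && _)%:R => c.
by rewrite -(mulrDl a b) -(mulrBl _ (a + b) c) !mulrA.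
Qed.

(** The only contribution is [d_0 Gamma^0_11 - Gamma^0_11 Gamma^1_01], where
    [Gamma^0_11 = - w w'] and [Gamma^1_01 = w' / w].  It equals [- w w''], and
    division by the determinant [w^2] gives [- w'' / w = -1]. *)
Lemma gauss_curvature_warped p : gauss_curvature warped p = -1.
Proof.
have w0 := lt0r_neq0 (width_gt0 (p 0 0)).
have detE : \det (metric warped p) = width (p 0 0) ^+ 2.
  rewrite (expand_det_row _ 0) !big_ord_recl big_ord0 /cofactor !mxE /=.
  by rewrite !mul0r !addr0 det_mx11 !mxE /= !mul1r ?expr0 ?mul1r.
have g10 : metric warped p 1 0 = 0 by rewrite !mxE /= mul0r.
have g00 : metric warped p 0 0 = 1 by rewrite !mxE /= mul1r.
have E011 : christoffel warped 0 1 1 =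
    (fun q => (fun r => - (width r * slope r)) (q 0 0)).
  by apply/funext => q; rewrite christoffel_warped /=; field.
have E001 : christoffel warped 0 0 1 = (fun q => (fun=> 0) (q 0 0)).
  by apply/funext => q; rewrite christoffel_warped /=; ring.
have D011 : is_derive (p 0 0) 1 ((fun r => - (width r * slope r)) : R -> R^o)
   (- (width (p 0 0) ^+ 2 + slope (p 0 0) ^+ 2)).
  have dw := is_derive_width (p 0 0); have ds := is_derive_slope (p 0 0).
  by apply: is_derive_eq; rewrite /GRing.scale /=; ring.
have D001 : is_derive (p 0 0) 1 ((fun=> 0) : R -> R^o) 0 by exact: is_derive_cst.
rewrite /gauss_curvature detE !big_ord_recl big_ord0.
have -> : lift ord0 ord0 = 1 :> 'I_2 by exact/val_inj.
rewrite g10 g00 mulr0 addr0 mulr1 addr0.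
rewrite /riemann !big_ord_recl big_ord0.
have -> : lift ord0 ord0 = 1 :> 'I_2 by exact/val_inj.
rewrite {1}E011 {1}E001 (partial_radial 0 D011) (partial_radial 1 D001).
rewrite !christoffel_warped /=.
by field.
Qed.

End Warped.

(** * Completeness of the warped products *)

Section Completeness.
Context {R : realType}.
Variable B : R.
Hypothesis B0 : 0 <= B.
Implicit Types (p q v : 'rV[R]_2) (r t : R) (c : R -> 'rV[R]_2).

Definition speed (g : form_field R) c (t : R) : R :=
  Num.sqrt (bilin (g (cylproj (c t))) (c^`()%classic t) (c^`()%classic t)).

Lemma speed_continuous c : C1_arc c -> continuous (speed (warped B) c).
Proof.
move=> [dc cc] t.
have coordc (F : R -> 'rV[R]_2) i : {for t, continuous F} ->
    {for t, continuous (fun s => F s 0 i : R)}.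
  move=> cF; apply: (@continuous_comp _ _ _ F (fun M => M 0 i : R) t cF).
  exact: coord_continuous.
have ct : {for t, continuous c}.
  by apply: differentiable_continuous; exact/derivable1_diffP.
have cw : {for t, continuous (fun s => width B (c s 0 0))}.
  apply: (@continuous_comp _ _ _ (fun s => c s 0 0) (width B)); first exact: coordc.
  apply: differentiable_continuous; apply/derivable1_diffP.
  by have [] := is_derive_width B (c t 0 0).
have -> : speed (warped B) c = (fun s => Num.sqrt (c^`()%classic s 0 0 ^+ 2 +
    width B (c s 0 0) ^+ 2 * c^`()%classic s 0 1 ^+ 2)).
  by apply/funext => s; rewrite /speed bilin_warped.
apply: (@continuous_comp _ _ _ (fun s => c^`()%classic s 0 0 ^+ 2 +
    width B (c s 0 0) ^+ 2 * c^`()%classic s 0 1 ^+ 2) Num.sqrt);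
  last exact: sqrt_continuous.
have c0 := coordc _ 0 (cc t); have c1 := coordc _ 1 (cc t).
apply: (@continuousD _ R^o _ (fun s => c^`()%classic s 0 0 * c^`()%classic s 0 0)
  (fun s => width B (c s 0 0) * width B (c s 0 0) *
    (c^`()%classic s 0 1 * c^`()%classic s 0 1))).
  exact: continuousM.
by apply: continuousM; exact: continuousM.
Qed.

(** The metric dominates dr^2, so the speed of an arc dominates the derivative
    of its radial coordinate. *)
Lemma arc_length_ge_radial c : C1_arc c ->
  ((`|c 1 0 0 - c 0 0 0|)%:E <= arc_length (warped B) c)%E.
Proof.
move=> C1c; have [dc cc] := C1c.
pose x (s : R) : R := c s 0 0; pose x' s : R := c^`()%classic s 0 0.
have dx (s : R) : is_derive s 1 x (x' s).
  split; first by have /derivable_mxP := dc s; exact.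
  by rewrite /x' derive1E (derive_mx (dc s)) mxE.
have cx' : continuous x'.
  move=> s; apply: (@continuous_comp _ _ _ c^`()%classic (fun M => M 0 0 : R) s (cc s)).
  exact: coord_continuous.
have cx : continuous x.
  move=> s; apply: differentiable_continuous; apply/derivable1_diffP.
  by have [] := dx s.
have mx' : measurable_fun (`[0%R, 1%R] : set R) (EFin \o x').
  apply/measurable_EFinP; apply: measurable_funTS; exact: continuous_measurable_fun.
have mspeed : measurable_fun (`[0%R, 1%R] : set R) (EFin \o speed (warped B) c).
  apply/measurable_EFinP; apply: measurable_funTS; apply: continuous_measurable_fun.
  exact: speed_continuous.
have FTC : (\int[lebesgue_measure]_(s in `[0%R, 1%R]) (x' s)%:E = (x 1)%:E - (x 0)%:E)%E.
  apply: continuous_FTC2 => //.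
  - exact: continuous_subspaceT.
  - split=> [s _||]; first by have [] := dx s.
      exact/cvg_at_right_filter/cx.
    exact/cvg_at_left_filter/cx.
  - by move=> s _; rewrite derive1E; have [_ ->] := dx s.
rewrite -/(x 1) -/(x 0) -EFinB in FTC *.
have -> : (`|x 1 - x 0|%:E = `|(x 1 - x 0)%:E|)%E by [].
rewrite -FTC; apply: (le_trans (le_abse_integral lebesgue_measure _ mx')) => //.
apply: ge0_le_integral => //.
- exact: measurableT_comp.
- move=> s _; rewrite lee_fin /speed bilin_warped -sqrtr_sqr ler_wsqrtr//.
  by rewrite lerDl mulr_ge0// sqr_ge0.
Qed.

Lemma curve_length_ge_radial s (x y : cylinder R) : curve_from_to s x y ->
  ((`|y.1 - x.1|)%:E <= curve_length (warped B) s)%E.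
Proof.
elim: s x => [|c s IHs] x /=.
  by move=> ->; rewrite subrr normr0 /curve_length big_nil.
move=> [C1c <- /IHs {}IHs]; rewrite /curve_length big_cons.
apply: le_trans (leeD (arc_length_ge_radial C1c) IHs).
by rewrite -EFinD lee_fin /= [leRHS]addrC ler_distD.
Qed.

Lemma dist_ge_radial (x y : cylinder R) :
  ((`|y.1 - x.1|)%:E <= riemannian_dist (warped B) x y)%E.
Proof. by apply: le_ereal_inf_tmp => _ [s /curve_length_ge_radial + <-]. Qed.

Lemma curve_from_to_cat s1 s2 (x y z : cylinder R) :
  curve_from_to s1 x y -> curve_from_to s2 y z -> curve_from_to (s1 ++ s2) x z.
Proof.
elim: s1 x => [|c s1 IHs] x /=; first by move=> ->.
by move=> [C1c xc /IHs + s2yz] => /(_ s2yz).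
Qed.

Lemma dist_triangle_lt (g : form_field R) (x y z : cylinder R) (a b : R) :
  (riemannian_dist g x y < a%:E)%E -> (riemannian_dist g y z < b%:E)%E ->
  (riemannian_dist g x z < (a + b)%:E)%E.
Proof.
move=> /ereal_inf_lt[_ [s1 xy <-] l1] /ereal_inf_lt[_ [s2 yz <-] l2].
apply: le_lt_trans (_ : curve_length g (s1 ++ s2) < _)%E.
  by apply: ereal_inf_lbound; exists (s1 ++ s2) => //; exact: curve_from_to_cat yz.
by rewrite /curve_length big_cat EFinD lteD.
Qed.

Lemma segment_C1_arc p v : C1_arc (fun t => p + t *: v) /\
  forall t, (fun s => p + s *: v)^`()%classic t = v.
Proof.
have D (t : R) : is_derive t 1 (fun s => p + s *: v) v.
  have := @is_derive_line _ _ id p v t (@derivable_id _ _ _ _).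
  by rewrite derive_id.
have E t : (fun s => p + s *: v)^`()%classic t = v.
  by rewrite derive1E; have [_ ->] := D t.
split=> //; split=> [t|]; first by have [] := D t.
have -> : (fun s => p + s *: v)^`()%classic = cst v by exact/funext.
by move=> t; exact: cst_continuous.
Qed.

Lemma dist_le_segment p q (K : R) : 0 <= K ->
  (forall t, 0 <= t <= 1 ->
     bilin (warped B (cylproj (p + t *: (q - p)))) (q - p) (q - p) <= K ^+ 2) ->
  (riemannian_dist (warped B) (cylproj p) (cylproj q) <= K%:E)%E.
Proof.
move=> K0 HK; have [C1c cE] := segment_C1_arc p (q - p).
set c := (fun t => p + t *: (q - p)) in C1c cE.
apply: (@le_trans _ _ (curve_length (warped B) [:: c])).
  apply: ereal_inf_lbound; exists [:: c] => //=; split => //.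
    by rewrite /c scale0r addr0.
  by rewrite /c scale1r addrC subrK.
rewrite /curve_length big_seq1.
have -> : K%:E = (\int[lebesgue_measure]_(t in `[0%R, 1%R]) (cst K%:E t))%E.
  rewrite integral_cst//= lebesgue_measure_itv/= lte_fin ltr01.
  by rewrite -EFinB subr0 mule1.
have mspeed : measurable_fun (`[0%R, 1%R] : set R) (EFin \o speed (warped B) c).
  apply/measurable_EFinP; apply: measurable_funTS; apply: continuous_measurable_fun.
  exact: speed_continuous.
apply: ge0_le_integral => //= t; rewrite in_itv/= => t01.
rewrite lee_fin cE -(ger0_norm K0) -sqrtr_sqr ler_wsqrtr//; exact: HK.
Qed.

Lemma width_le (M r : R) : `|r| <= M -> width B r <= (1 + B) * expR M.
Proof.
rewrite ler_norml => /andP[rl ru]; rewrite mulrDl mul1r lerD ?ler_expR//.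
by rewrite ler_wpM2l// ler_expR lerNl.
Qed.

Lemma bilin_warped_le (M : R) p v : `|p 0 0| <= M ->
  bilin (warped B (cylproj p)) v v <= ((1 + (1 + B) * expR M) * `|v|) ^+ 2.
Proof.
move=> pM; rewrite bilin_warped /=.
have wM := width_le pM; have w0 := width_gt0 B0 (p 0 0).
move: (width B _) ((1 + B) * _) wM w0 => w W wW w0.
have W0 : 0 <= W by exact: le_trans (ltW w0) wW.
have v0 := normr_coord_le v 0; have v1 := normr_coord_le v 1.
have H i : v 0 i ^+ 2 <= `|v| ^+ 2.
  by rewrite -real_normK ?num_real// ler_pXn2r ?nnegrE// normr_coord_le.
apply: (@le_trans _ _ (`|v| ^+ 2 + W ^+ 2 * `|v| ^+ 2)).
  apply: lerD => //; apply: ler_pM; rewrite ?sqr_ge0//.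
  by rewrite ler_pXn2r ?nnegrE// ltW.
rewrite -[X in X + _]mul1r -mulrDl exprMn ler_wpM2r ?sqr_ge0//.
by rewrite sqrrD expr1n mul1r lerD2r lerDl mulrn_wge0.
Qed.

(** Representatives in a closed fundamental strip, in which the points with
    bounded radial coordinate form a compact set. *)
Lemma fundamental_lift (x : cylinder R) :
  exists p, [/\ cylproj p = x, p 0 0 = x.1 & 0 <= p 0 1 <= 1].
Proof.
have [q qx] := cylproj_surj x.
exists (pt (q 0 0) (q 0 1 - (Num.floor (q 0 1))%:~R)).
have /andP[fl fu] := floor_itv (q 0 1); rewrite pt0 pt1 -qx; split=> //.
  apply/cylproj_eqP; rewrite pt0 pt1; split=> //.
  by rewrite addrAC subrr sub0r rpredN intr_int.
by rewrite subr_ge0 fl /= lerBlDl ltW//; move: fu; rewrite intrD.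
Qed.

(** The radial coordinate is 1-Lipschitz, so the terms of a Cauchy sequence have
    lifts in a compact rectangle.  They accumulate at some point [z], near which
    straight segments bound the distance by a multiple of the Euclidean one.
    A Cauchy sequence with an accumulation point converges to it. *)
Lemma warped_complete : complete_metric (warped B).
Proof.
move=> u Cu.
have [N0 HN0] := Cu 1 ltr01.
pose p n := projT1 (cid (fundamental_lift (u n))).
have pP n : [/\ cylproj (p n) = u n, p n 0 0 = (u n).1 & 0 <= p n 0 1 <= 1].
  exact: (projT2 (cid (fundamental_lift (u n)))).
pose M := `|(u N0).1| + 1.
have M1 : 1 <= M by rewrite lerDr.
have pM n : (N0 <= n)%N -> forall i, `|p n 0 i| <= M.
  move=> Nn; have [_ p0 /andP[p1 p1']] := pP n.
  have pM0 : `|p n 0 0| <= M.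
    have := le_lt_trans (dist_ge_radial _ _) (HN0 N0 n (leqnn _) Nn).
    rewrite lte_fin -p0 => /ltW H.
    by rewrite -[X in `|X|](subrK (u N0).1) addrC (le_trans (ler_normD _ _))// lerD2l.
  move=> i; have [->//|i0] := eqVneq i 0.
  have -> : i = 1 by apply/val_inj; case: i i0 => -[|[|]].
  by rewrite ger0_norm// (le_trans p1').
have [z [zM zp]] : [set z : 'rV[R]_2 | forall i, `[- M, M]%classic (z 0 i)] `&`
    cluster (p @ \oo) !=set0.
  apply: (@rV_compact R 2 (fun=> `[- M, M]%classic)) => [_|];
    first exact: segment_compact.
  exists N0 => // n /= Nn i; rewrite /= in_itv/= -ler_norml; exact: pM.
exists (cylproj z) => e e0.
have [N HN] := Cu (e / 2) ltac:(by rewrite divr_gt0).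
exists N => n Nn.
set K := 1 + (1 + B) * expR M.
have K0 : 0 < K.
  by rewrite ltr_wpDr// mulr_ge0// ?expR_ge0// addr_ge0.
have [m [Nm N0m zpm]] : exists m, [/\ (N <= m)%N, (N0 <= m)%N & `|z - p m| < e / 2 / K].
  have [_ [[m /= Nm <-]]] : [set p m | m in [set m | (maxn N N0 <= m)%N]] `&`
      ball z (e / 2 / K) !=set0.
    apply: zp.
      by exists (maxn N N0) => // m /= Nm; exists m.
    by apply: nbhsx_ballx; rewrite !divr_gt0.
  rewrite -ball_normE /= => zpm; exists m; split=> //.
    exact: leq_trans (leq_maxl _ _) Nm.
  exact: leq_trans (leq_maxr _ _) Nm.
rewrite [e]splitr; apply: (dist_triangle_lt (y := u m)); first exact: HN.
have [<- _ _] := pP m.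
apply: (@le_lt_trans _ _ (K * `|z - p m|)%:E); last first.
  by rewrite lte_fin mulrC -ltr_pdivlMr.
apply: dist_le_segment => [|t /andP[t0 t1]]; first by rewrite mulr_ge0// ltW.
apply: bilin_warped_le.
have zM0 : `|z 0 0| <= M by rewrite ler_norml; have := zM 0; rewrite /= in_itv.
have -> : (p m + t *: (z - p m)) 0 0 = (1 - t) * p m 0 0 + t * z 0 0.
  by rewrite !mxE; ring.
apply: le_trans (ler_normD _ _) _; rewrite !normrM (ger0_norm t0).
rewrite (ger0_norm (_ : 0 <= 1 - t)) ?subr_ge0//.
have -> : M = (1 - t) * M + t * M by ring.
by rewrite lerD// ler_wpM2l// ?subr_ge0// pM.
Qed.

Lemma warped_negative : uniformly_negative (warped B).
Proof. by exists 1 => // p; rewrite gauss_curvature_warped. Qed.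

Definition warped_Neg : Neg R :=
  MkNeg (warped_riemannian B0) warped_complete warped_negative.

End Completeness.

(** * A cusp and a funnel *)

Section CuspAndFunnel.
Context {R : realType}.
Implicit Types (p q v : 'rV[R]_2) (r t : R) (A : set (cylinder R))
  (f : cylinder R -> R).

Lemma grad_bounded_segment (g : form_field R) C f p v (K : R) : 0 <= K ->
  grad_bounded g C f ->
  (forall s, `|s| <= 1 -> C * bilin (g (cylproj (p + s *: v))) v v <= K ^+ 2) ->
  `|f (cylproj (p + v)) - f (cylproj p)| <= K.
Proof.
move=> K0 gf HK.
have D (s : R) : `|s| <= `|1| :> R -> is_derive s 1
    (fun s => f (cylproj (p + s *: v)) : R^o)
    ('D_v (f \o @cylproj R : 'rV[R]_2 -> R^o) (p + s *: v)).
  move=> _; apply: (@is_derive_line _ _ (f \o @cylproj R : 'rV[R]_2 -> R^o)).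
  by apply: diff_derivable; have [] := gf (p + s *: v).
have [s] := MVT_unordered D; rewrite normr1 scale1r scale0r addr0 mulr1 => s1 ->.
rewrite -(ler_pXn2r (n := 2)) ?nnegrE// real_normK ?num_real//.
have [_ Df] := gf (p + s *: v).
exact: le_trans (Df v) (HK s s1).
Qed.

Lemma grad_bounded_fst (B : R) : grad_bounded (warped B) 1 fst.
Proof.
move=> p; have D := is_derive_id (p 0 0) (1 : R).
split=> [|v].
  exact: (differentiable_coord_comp (phi := id) (p := p) (i := 0) (@derivable_id _ _ _ _)).
have [_] := is_derive_coord_comp (phi := id) v D.
rewrite mulr1 => E.
rewrite (_ : 'D_v _ p = v 0 0)// mul1r bilin_warped lerDl.
by rewrite mulr_ge0// sqr_ge0.
Qed.

Lemma far_reaching_radial (B : R) A :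
  (forall M : R, exists2 x, A x & M < `|x.1|) -> far_reaching (warped B) A.
Proof. by move=> AM; exists 1, fst; split => //; exact: grad_bounded_fst. Qed.

(** The horocircle at height [ln e] has length [e] and separates the cusp from
    the wide end, and the radial coordinate is unbounded on both sides. *)
Lemma cusp_pinched : pinched (warped (0 : R)).
Proof.
move=> e e0; exists [set x | x.1 < ln e]; split.
- have frontierE x : frontier [set x : cylinder R | x.1 < ln e] x -> x.1 = ln e.
    move=> [p <- /= np]; apply: contra_notP np => /eqP.
    have cp : {for p, continuous (fun q : 'rV[R]_2 => q 0 0)} by exact: coord_continuous.
    rewrite neq_lt => /orP[pr|pr].
    - have : \forall q \near p, (q : 'rV[R]_2) 0 0 < ln e
        by exact: (@cvgr_lt R _ (nbhs p) _ (fun q : 'rV[R]_2 => q 0 0) (p 0 0) cp).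
      by apply: filterS => q qr; rewrite qr pr.
    - have : \forall q \near p, ln e < (q : 'rV[R]_2) 0 0
        by exact: (@cvgr_gt R _ (nbhs p) _ (fun q : 'rV[R]_2 => q 0 0) (p 0 0) cp).
      by apply: filterS => q qr; rewrite !ltNge !ltW.
  move=> f gf x y /frontierE xr /frontierE yr.
  have [p [px p0 /andP[p1 p1']]] := fundamental_lift x.
  have [q [qy q0 /andP[q1 q1']]] := fundamental_lift y.
  rewrite -px -qy; have -> : p = q + (p - q) by rewrite addrC subrK.
  apply: (grad_bounded_segment (ltW e0) gf) => s _.
  rewrite mul1r bilin_warped /= !mxE p0 q0 xr yr subrr mulr0 addr0 expr0n add0r.
  rewrite /width mul0r addr0 lnK ?posrE// ler_piMr ?sqr_ge0//.
  rewrite -real_normK ?num_real// exprn_ile1//.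
  rewrite ler_norml; apply/andP; split; lra.
- apply: far_reaching_radial => M.
  exists (cylproj (pt (- (`|M| + `|ln e| + 1)) 0)); rewrite /= pt0.
    by have := ler_norm (- ln e); rewrite normrN; have := normr_ge0 M; lra.
  rewrite normrN ger0_norm; last by rewrite !addr_ge0.
  by have := ler_norm M; have := normr_ge0 (ln e); lra.
- apply: far_reaching_radial => M.
  exists (cylproj (pt (`|M| + `|ln e| + 1) 0)); rewrite /= pt0.
    apply/negP; rewrite -leNgt.
    by have := ler_norm (ln e); have := normr_ge0 M; lra.
  rewrite ger0_norm; last by rewrite !addr_ge0.
  by have := ler_norm M; have := normr_ge0 (ln e); lra.
Qed.

Lemma cosD_int (x y : R) : y \is a Num.int -> cos (x + y * (pi *+ 2)) = cos x.
Proof.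
move=> /intrP[[n|n] ->].
  by rewrite mulr_natl; exact: periodicn (@cosD2pi R) n x.
rewrite NegzE mulrNz mulNr mulr_natl.
by rewrite -[in RHS](subrK ((pi *+ 2) *+ n.+1) x) (periodicn (@cosD2pi R)).
Qed.

(** The function cos (2 pi theta) / (2 pi), whose gradient is at most [1 / w].
    It detects sets that surround the cylinder. *)
Definition angular (x : cylinder R) : R := cos (repr x.2 * (pi *+ 2)) / (pi *+ 2).

Lemma angular_cylproj p : angular (cylproj p) = cos (p 0 1 * (pi *+ 2)) / (pi *+ 2).
Proof.
rewrite /angular /=; set t := repr _.
have tp : t - p 0 1 \is a Num.int by apply/circle_eqP; rewrite reprK.
by rewrite -[in LHS](subrK (p 0 1) t) addrC mulrDl cosD_int.
Qed.

Lemma pi2_gt0 : 0 < pi *+ 2 :> R.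
Proof. by rewrite mulrn_wgt0// pi_gt0. Qed.

Lemma grad_bounded_angular (B : R) : 1 <= 2 * B -> grad_bounded (warped B) 1 angular.
Proof.
move=> B1 p.
pose phi t := cos (t * (pi *+ 2)) / (pi *+ 2) : R.
have aE : angular \o @cylproj R = (fun q => phi (q 0 1)).
  by apply/funext => q; exact: angular_cylproj.
have w0 := lt0r_neq0 pi2_gt0.
have D : is_derive (p 0 1) 1 (phi : R -> R^o) (- sin (p 0 1 * (pi *+ 2))).
  have dlin : is_derive (p 0 1) 1 (fun t : R => t * (pi *+ 2)) (pi *+ 2).
    by apply: is_derive_eq; rewrite scaler0 add0r [_%:A]mulr1.
  have dcos := @is_derive1_comp R cos (fun t => t * (pi *+ 2)) (p 0 1) _ _
    (is_derive_cos _) dlin.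
  have -> : phi = (pi *+ 2)^-1 \*: (cos \o (fun t : R => t * (pi *+ 2))).
    by apply/funext => t; rewrite /phi /= mulrC.
  by apply: is_derive_eq; rewrite [_ *: _]mulrC mulfK.
rewrite aE; split=> [|v].
  by apply: differentiable_coord_comp; have [] := D.
have [_ ->] := is_derive_coord_comp v D.
rewrite exprMn sqrrN mul1r bilin_warped.
apply: (@le_trans _ _ (v 0 1 ^+ 2)).
  by rewrite ler_piMr ?sqr_ge0// sin2cos2 lerBlDr lerDl sqr_ge0.
rewrite (@le_trans _ _ (width B (p 0 0) ^+ 2 * v 0 1 ^+ 2))//; last first.
  by rewrite lerDr sqr_ge0.
rewrite ler_peMl ?sqr_ge0// width_sqr /exp2_comb mul1r.
rewrite -addrA addrCA (le_trans B1)// lerDl addr_ge0 ?sqr_ge0//.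
by rewrite mulr_ge0// sqr_ge0.
Qed.

Lemma locally_constant (P : R -> Prop) :
  (forall t, \forall s \near t, P s <-> P t) -> forall s t, P s -> P t.
Proof.
move=> HP s t Ps.
suff /seteqP[_ /(_ t I)] : [set t | P t] = [set: R] by [].
have conn : connected [set: R] by apply/connected_intervalP => ? ? _ _ ? _.
apply: conn; first by exists s.
- exists [set t | P t]; last by rewrite setTI.
  rewrite openE => u /= Pu; rewrite /interior /=.
  by apply: filterS (HP u) => w [_]; exact.
- exists [set t | P t]; last by rewrite setTI.
  rewrite -openC openE => u /= Pu; rewrite /interior /=.
  by apply: filterS (HP u) => w [+ _] => /contra_not; exact.
Qed.

Lemma frontier_avoiding_line A p v :
  (forall t, ~ frontier A (cylproj (p + t *: v))) ->
  A (cylproj p) -> A (cylproj (p + v)).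
Proof.
move=> nA Ap.
suff : forall s t : R, A (cylproj (p + s *: v)) -> A (cylproj (p + t *: v)).
  by move=> /(_ 0 1); rewrite scale0r scale1r addr0; exact.
apply: (@locally_constant (fun s => A (cylproj (p + s *: v)))) => t.
have near_A : \forall q \near p + t *: v, A (cylproj q) <-> A (cylproj (p + t *: v)).
  by apply: contra_notP (nA t) => H; exists (p + t *: v).
have ct : {for t, continuous (fun s : R => p + s *: v)}.
  apply: differentiable_continuous; apply/derivable1_diffP.
  by have [[]] := segment_C1_arc p v.
exact: ct _ near_A.
Qed.

Lemma frontier_avoiding_pt A (a b c d : R) :
  (forall t, ~ frontier A (cylproj (pt (a + t * (c - a)) (b + t * (d - b))))) ->
  A (cylproj (pt a b)) -> A (cylproj (pt c d)).
Proof.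
move=> nA Aab.
have lineE t : pt a b + t *: (pt c d - pt a b) = pt (a + t * (c - a)) (b + t * (d - b)).
  by rewrite [LHS]ptE !mxE /= !(mulr0, mulr1, addr0, add0r).
have -> : pt c d = pt a b + (pt c d - pt a b) by rewrite addrC subrK.
by apply: frontier_avoiding_line => // t; rewrite lineE.
Qed.

(** A strip is covered by segments issuing from one point, of bounded length and
    in a region where the metric is bounded. *)
Lemma strip_not_far_reaching (B M : R) A : 0 <= B -> 0 <= M ->
  A `<=` [set x | `|x.1| <= M] -> ~ far_reaching (warped B) A.
Proof.
move=> B0 M0 AM [C [f [gf uf]]].
pose K := (`|C| + 1) * ((1 + (1 + B) * expR M) * (M + 1)).
have E0 : 0 <= 1 + (1 + B) * expR M.
  by rewrite addr_ge0// mulr_ge0 ?expR_ge0// addr_ge0.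
have M10 : 0 <= M + 1 by rewrite addr_ge0.
have EM0 : 0 <= (1 + (1 + B) * expR M) * (M + 1) by exact: mulr_ge0.
have K0 : 0 <= K by apply: mulr_ge0 => //; rewrite addr_ge0.
have [x Ax] := uf (`|f (cylproj 0)| + K); apply/negP; rewrite -leNgt.
have [p [px p0 /andP[p1 p1']]] := fundamental_lift x.
have pM : `|p 0 0| <= M by rewrite p0; exact: AM.
rewrite -[f x](subrK (f (cylproj 0))) addrC (le_trans (ler_normD _ _))// lerD2l.
rewrite -px -[in X in X - _](add0r p).
apply: (grad_bounded_segment K0 gf) => s s1.
have np : `|p| <= M + 1.
  rewrite [p]ptE norm_pt_le//; first by rewrite (le_trans pM) ?lerDl.
  by rewrite ger0_norm// (le_trans p1')// lerDr.
have sM : `|(0 + s *: p) 0 0| <= M.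
  by rewrite !mxE add0r normrM (le_trans _ pM)// ler_piMl.
rewrite exprMn.
apply: (@le_trans _ _ (`|C| * bilin (warped B (cylproj (0 + s *: p))) p p)).
  rewrite ler_wpM2r ?ler_norm// bilin_warped addr_ge0 ?sqr_ge0//.
  by rewrite mulr_ge0// sqr_ge0.
apply: ler_pM => //.
- by rewrite bilin_warped addr_ge0 ?sqr_ge0// mulr_ge0// sqr_ge0.
- rewrite sqrrD expr1n mulr1 -addrA addrCA; have := normr_ge0 C.
  by move: `|C| => c c0; rewrite mulr2n; nra.
apply: le_trans (bilin_warped_le B0 _ sM) _.
by rewrite ler_pXn2r ?nnegrE ?mulr_ge0// ler_wpM2l.
Qed.

(** Let the frontier of [A] have small size.  The radial coordinate confines it
    to a strip [|r| <= M].  The angular function takes values 1 / pi apart on the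
    lines theta = 0 and theta = 1/2, so the frontier misses one of these lines.
    That line together with the circles outside the strip is a connected set
    disjoint from the frontier, so [A] or its complement lies in the strip and
    cannot reach an end. *)
Lemma funnel_not_pinched (B : R) : 1 <= 2 * B -> ~ pinched (warped B).
Proof.
move=> B1 Pg; have B0 : 0 <= B by lra.
have e0 : 0 < (pi *+ 2)^-1 :> R by rewrite invr_gt0 pi2_gt0.
have [A [Ae far1 far2]] := Pg _ e0.
have [M M0 AM] : exists2 M : R, 0 <= M & frontier A `<=` [set x | `|x.1| <= M].
  have [[x0 Ax0]|nA] := pselect (frontier A !=set0); last first.
    by exists 0 => // x Ax; exfalso; apply: nA; exists x.
  exists (`|x0.1| + (pi *+ 2)^-1); first by rewrite addr_ge0// ltW.
  move=> x Ax /=; have := Ae _ (grad_bounded_fst B) x x0 Ax Ax0.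
  by move=> H; rewrite -[x.1](subrK x0.1) addrC (le_trans (ler_normD _ _))// lerD2l.
have [th Ath] : exists th : R, forall r, ~ frontier A (cylproj (pt r th)).
  apply: contrapT => H.
  have [r1 A1] : exists r, frontier A (cylproj (pt r 0)).
    by apply: contrapT => H'; apply: H; exists 0 => r Ar; apply: H'; exists r.
  have [r2 A2] : exists r, frontier A (cylproj (pt r 2^-1)).
    by apply: contrapT => H'; apply: H; exists 2^-1 => r Ar; apply: H'; exists r.
  have := Ae _ (grad_bounded_angular B1) _ _ A1 A2.
  rewrite !angular_cylproj !pt1 mul0r cos0.
  have -> : 2^-1 * (pi *+ 2) = pi :> R by rewrite -[pi *+ 2]mulr_natl mulKf.
  rewrite cospi mulN1r mul1r opprK ger0_norm; last by rewrite addr_ge0// ltW.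
  by apply/negP; rewrite -ltNge ltrDl.
have constA a b c d : M < `|a| -> M < `|c| ->
    A (cylproj (pt a b)) -> A (cylproj (pt c d)).
  move=> Ma Mc Aab.
  have vert r u w : M < `|r| -> A (cylproj (pt r u)) -> A (cylproj (pt r w)).
    move=> Mr; apply: frontier_avoiding_pt => t; rewrite subrr mulr0 addr0.
    by move/AM => /=; rewrite pt0 leNgt Mr.
  (* along the circle at height a, the line theta = th, the circle at height c *)
  apply: (vert _ th) => //.
  apply: (@frontier_avoiding_pt _ a th); last exact: vert Aab.
  by move=> t; rewrite subrr mulr0 addr0.
have [[x [xM Ax]]|nA] := pselect (exists x : cylinder R, M < `|x.1| /\ A x).
  apply: (strip_not_far_reaching B0 M0 _ far2) => y nAy /=.
  rewrite leNgt; apply/negP => yM; apply: nAy.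
  have [p [px p0 _]] := fundamental_lift x.
  have [q [qy q0 _]] := fundamental_lift y.
  rewrite -qy [q]ptE; apply: (constA (p 0 0) (p 0 1)); rewrite ?p0 ?q0//.
  by rewrite -p0 -ptE px.
apply: (strip_not_far_reaching B0 M0 _ far1) => y Ay /=.
by rewrite leNgt; apply/negP => yM; apply: nA; exists y.
Qed.

End CuspAndFunnel.

Theorem theorem1p1 (R : realType) : ~ connected [set: moduli_space R].
Proof.
apply: moduli_space_disconnected.
  by exists (warped_Neg (lexx 0)); exact: cusp_pinched.
exists (warped_Neg ler01); apply: funnel_not_pinched.
by rewrite mulr1 ler1n.
Qed.
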